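(* Let $\lambda>0$, $\rho>1$, $n\ge1$, and let $X,X_1,\ldots,X_n$ be i.i.d. $\mathrm{Exp}(\lambda)$. Let $J_n\coloneqq\log_\rho X_{(n)}$ where $X_{(n)}=\max_i X_i$, and define \[p_{\mathrm{last}}\coloneqq\Pr\left(\rho^{\lceil J_n\rceil-1}<X\le\rho^{\lceil J_n\rceil}\right),\qquad p_{\mathrm{tail}}\coloneqq\Pr\left(X>\rho^{\lceil J_n\rceil}\right)\] (probabilities taken jointly over $X$ and $X_1,\ldots,X_n$). Then \[p_{\mathrm{last}}\le nB(1+1/\rho,n)-nB(1+\rho,n)\sim\frac{\Gamma(1+1/\rho)}{n^{1/\rho}}-\frac{\Gamma(1+\rho)}{n^\rho},\] \[\frac{\Gamma(1+\rho)}{n^\rho}\sim nB(1+\rho,n)\le p_{\mathrm{tail}}\le\frac{1}{n+1}\sim\frac1n,\] where the asymptotic equivalences hold as $n\to\infty$.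
   Context: $\mathrm{Exp}(\lambda)$ has density $\lambda e^{-\lambda x}$ on $(0,\infty)$. $B$ is the Beta function and $\Gamma$ the Gamma function; $\sim$ means the ratio tends to 1. *)

(* Defs.v *)
From HB Require Import structures.
From mathcomp Require Import all_boot all_order all_algebra.
From mathcomp Require Import all_classical all_reals all_analysis.
Set Implicit Arguments. Unset Strict Implicit. Unset Printing Implicit Defensive.
Import Order.TTheory GRing.Theory Num.Theory.
Import numFieldNormedType.Exports.
Local Open Scope classical_set_scope.
Local Open Scope ring_scope.

(* Mutual independence of a finite family of real random variables:
   for all Borel sets B_i, P(/\_i {Y_i in B_i}) = prod_i P(Y_i in B_i).
   (Taking B_i = setT recovers the product rule for every subfamily.) *)
Definition mutually_independent {d} {T : measurableType d} {R : realType}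
  (P : probability T R) {I : finType} (Y : I -> T -> R) : Prop :=
  forall B : I -> set R, (forall i, measurable (B i)) ->
    P (\bigcap_(i in [set: I]) (Y i @^-1` B i)) =
    (\prod_(i : I) P (Y i @^-1` B i))%E.

Definition family_XXs {T R : Type} {n : nat} (X : T -> R) (Xs : 'I_n -> T -> R)
  : option 'I_n -> T -> R :=
  fun o => match o with None => X | Some i => Xs i end.

Definition sample_max {T : Type} {R : realType} {n : nat} (Xs : 'I_n -> T -> R)
  (w : T) : R := \big[Num.max/0]_(i < n) Xs i w.

Definition logb {R : realType} (rho x : R) : R := ln x / ln rho.

Definition Beta {R : realType} (a b : R) : R :=
  fine (\int[@lebesgue_measure R]_(t in `]0%R, 1%R[) ((t `^ (a - 1) * (1 - t) `^ (b - 1))%:E))%E.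

Definition Gamma {R : realType} (x : R) : R :=
  fine (\int[@lebesgue_measure R]_(t in `]0%R, +oo[) ((t `^ (x - 1) * expR (- t))%:E))%E.

Definition asym_equiv {R : realType} (f g : nat -> R) : Prop :=
  (fun n => f n / g n) @ \oo --> (1 : R).

(* Main.v *)
Require Import Defs.
From HB Require Import structures.
From mathcomp Require Import all_boot all_order all_algebra.
From mathcomp Require Import all_classical all_reals all_analysis.
From mathcomp Require Import measurable_realfun ring lra.
Import Order.TTheory GRing.Theory Num.Theory.
Import numFieldNormedType.Exports.
Local Open Scope classical_set_scope.
Local Open Scope ring_scope.

(* Off a null event, the maximum M of the sample satisfies
   M <= rho^K < rho M, so the events are sandwiched between events of the form
   {a M < X} with a = 1, rho, 1/rho.  Conditioning on X, P(a M < X) is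
   E[(1 - exp(-lam X / a))^n; X >= 0].  This expectation and the Beta integral
   obey the same recursion F(c, k+1) = F(c, k) - F(c+1, k), which pins both
   down to k! / (c (c+1) ... (c+k)); hence P(a M < X) = n B(1+a, n).
   The asymptotics are Euler's limit formula: m^a m B(1+a, m) is the integral
   of s^a (1 - s/m)^(m-1) over ]0, m[, which converges to Gamma(1+a) by
   dominated convergence. *)

(** * Beta integrals *)

(* Equals [B(c, k+1)] for [0 < c]. *)
Definition beta_quot {R : realType} (c : R) (k : nat) : R :=
  k`!%:R / \prod_(j < k.+1) (c + j%:R).

(** Over the common denominator [c (c+1) ... (c+k+1)] the numerators are [k! (c+k+1)] and [k! c],
    whose difference is [(k+1)!]. *)
Lemma beta_quotB {R : realType} (c : R) k : 0 < c ->
  beta_quot c k.+1 = beta_quot c k - beta_quot (c + 1) k.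
Proof.
move=> c0; rewrite /beta_quot.
have pos (x : R) m : 0 < x -> 0 < \prod_(j < m) (x + j%:R).
  by move=> x0; apply: prodr_gt0 => j _; rewrite ltr_wpDr.
rewrite big_ord_recr /=.
set A := \prod_(j < k.+1) _.
have -> : A = c * \prod_(j < k) (c + 1 + j%:R).
  rewrite /A big_ord_recl addr0; congr (_ * _); apply: eq_bigr => j _.
  by rewrite lift0 -natr1 addrA addrAC.
rewrite [X in _ = _ - _ / X]big_ord_recr /=.
set B := \prod_(j < k) _.
have B0 : 0 < B by apply: pos; rewrite ltr_wpDr.
have k0 : 0 <= k%:R :> R by [].
rewrite factS natrM -[k.+1]addn1 natrD.
field.
by rewrite !gt_eqF//; lra.
Qed.

(** The recursion lowers [k] and only ever raises [c], so induction on [k] never leaves [c >= b].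
    The threshold [b] keeps the exponents in the later integrands nonnegative, where those
    integrands are bounded. *)
Lemma beta_quot_uniq {R : realType} (b : R) (F : R -> nat -> R) : 0 < b ->
  (forall c, b <= c -> F c 0%N = c^-1) ->
  (forall c k, b <= c -> F c k.+1 = F c k - F (c + 1) k) ->
  forall c k, b <= c -> F c k = beta_quot c k.
Proof.
move=> b0 F0 FS c k; elim: k c => [|k IH] c bc.
  by rewrite F0// /beta_quot big_ord_recl big_ord0 addr0 mulr1 fact0 mul1r.
rewrite FS// !IH//; last by rewrite (le_trans bc)// lerDl.
by rewrite beta_quotB// (lt_le_trans b0).
Qed.

Lemma continuous_powR_itv {R : realType} (c L : R) : 0 < c -> 0 < L ->
  {within `[0, L], continuous (fun t : R => t `^ c)}.
Proof.
move=> c0 L0.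
have cont (x : R) : 0 < x -> {for x, continuous (fun t : R => t `^ c)}.
  move=> x0; apply: differentiable_continuous; apply/derivable1_diffP.
  by apply: derivable_powR; rewrite in_itv/= x0.
apply/continuous_within_itvP => //; split.
- by move=> x; rewrite in_itv/= => /andP[x0 _]; exact: cont.
- by rewrite powR0 ?gt_eqF//; exact: powR_cvg0.
- by apply: cvg_at_left_filter; exact: cont.
Qed.

(** The integrand is bounded by [L ^ c] on an interval of finite length; this is where [c > 0]
    enters. *)
Lemma integrable_powR_onem {R : realType} (c L : R) (k : nat) :
    0 < c -> 0 < L ->
  (@lebesgue_measure R).-integrable `]0, L[
    (EFin \o (fun t => t `^ c * (1 - t / L) ^+ k)).
Proof.
move=> c0 L0; apply: measurable_bounded_integrable => //.
- by rewrite /= lebesgue_measure_itv/= lte_fin L0 EFinN sube0 ltry.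
- apply: measurable_funTS; apply: measurable_funM; first exact: measurable_powR.
  apply: measurable_funX; apply: measurable_funB => //.
  exact: measurable_funM.
- exists (L `^ c); split; first exact: num_real.
  move=> M LM t /=; rewrite in_itv/= => /andP[t0 tL].
  have u0 : 0 <= 1 - t / L by rewrite subr_ge0 ler_pdivrMr// mul1r ltW.
  rewrite ger0_norm ?mulr_ge0 ?powR_ge0 ?exprn_ge0//.
  rewrite (le_trans _ (ltW LM))// -[leRHS]mulr1 ler_pM ?powR_ge0 ?exprn_ge0//.
    by rewrite ge0_ler_powR ?nnegrE ?ltW.
  by rewrite exprn_ile1// lerBlDr lerDl divr_ge0 ?ltW.
Qed.

Lemma Rintegral_powR_itv {R : realType} (c L : R) : 0 < c -> 0 < L ->
  \int[@lebesgue_measure R]_(t in `]0, L[) (t `^ c) = L `^ (c + 1) / (c + 1).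
Proof.
move=> c0 L0.
have mp A : measurable_fun A (fun t : R => (t `^ c)%:E).
  by apply: measurable_funTS; apply/measurable_EFinP; exact: measurable_powR.
have c10 : 0 < c + 1 by rewrite ltr_wpDr.
(* The endpoints are null; adding them gives the closed interval on which the fundamental theorem of
   calculus is applied. *)
rewrite /Rintegral integral_itv_obnd_cbnd// integral_itv_bndo_bndc//.
rewrite (continuous_FTC2 (F := fun t => (c + 1)^-1 * t `^ (c + 1)))//=.
- by rewrite powR0 ?gt_eqF// mulr0 subr0 mulrC.
- exact: continuous_powR_itv.
- have := continuous_powR_itv _ _ c10 L0.
  move=> /(continuous_within_itvP _ L0)[_ p0 pL]; split.
  + move=> x; rewrite in_itv/= => /andP[x0 _]; apply: derivableM => //.
    by apply: derivable_powR; rewrite in_itv/= x0.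
  + by apply: cvgM => //; exact: cvg_cst.
  + by apply: cvgM => //; exact: cvg_cst.
- move=> x; rewrite in_itv/= => /andP[x0 _].
  rewrite derive1Ml ?powR_derive1 ?in_itv/= ?x0//.
    by rewrite addrK mulKf// gt_eqF.
  by apply: derivable_powR; rewrite in_itv/= x0.
Qed.

(** Dividing by [L ^ x] turns the integral into a solution [F] of the Beta recursion, since
    [u^(j+1) = u^j - (t/L) u^j] for [u = 1 - t/L]. The free length [L] serves both uses: [L = 1] for
    Beta, [L = m+1] for the Gamma limit. *)
Lemma Rintegral_powR_onem {R : realType} (c L : R) (k : nat) : 0 < c -> 0 < L ->
  \int[@lebesgue_measure R]_(t in `]0, L[) (t `^ c * (1 - t / L) ^+ k) =
  L `^ (c + 1) * beta_quot (c + 1) k.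
Proof.
move=> c0 L0.
pose F x j := \int[@lebesgue_measure R]_(t in `]0, L[)
  (t `^ (x - 1) * (1 - t / L) ^+ j) / L `^ x.
have Lneq0 x : L `^ x != 0 by rewrite gt_eqF// powR_gt0.
suff -> : beta_quot (c + 1) k = F (c + 1) k.
  by rewrite /F addrK mulrC divfK.
apply/esym/(beta_quot_uniq (c + 1)) => //.
- by rewrite ltr_wpDr.
- move=> x cx; rewrite /F.
  under eq_Rintegral do rewrite expr0 mulr1.
  rewrite Rintegral_powR_itv//; last by rewrite subr_gt0; lra.
  by rewrite subrK mulrAC divff// mul1r.
- move=> x j cx; rewrite /F.
  have x1 : 0 < x - 1 by rewrite subr_gt0; lra.
  have -> : L `^ (x + 1) = L `^ x * L.
    by rewrite -mulr_powRB1 ?addrK 1?mulrC//; lra.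
  rewrite invfM (mulrA _ (L `^ x)^-1) (mulrAC _ (L `^ x)^-1) -mulrBl.
  have i1 := integrable_powR_onem _ _ j x1 L0.
  have i2 : lebesgue_measure.-integrable `]0, L[
      (EFin \o (fun t : R => t `^ (x + 1 - 1) * (1 - t / L) ^+ j)).
    by apply: integrable_powR_onem; lra.
  congr (_ / _); rewrite -RintegralZr// -RintegralB//; last first.
    have -> : EFin \o (fun t : R => t `^ (x + 1 - 1) * (1 - t / L) ^+ j / L) =
        (fun t => (t `^ (x + 1 - 1) * (1 - t / L) ^+ j)%:E * L^-1%:E)%E by [].
    exact: integrableZr.
  apply: eq_Rintegral => t; rewrite inE/= in_itv/= => /andP[t0 _].
  have -> : t `^ (x + 1 - 1) = t `^ (x - 1) * t.
    by rewrite addrK mulrC mulr_powRB1//; lra.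
  by rewrite exprS; ring.
Qed.

Lemma BetaE {R : realType} (a : R) (n : nat) : 0 < a -> (0 < n)%N ->
  Beta (1 + a) n%:R = beta_quot (1 + a) n.-1.
Proof.
move=> a0 n0; have := Rintegral_powR_onem _ _ n.-1 a0 ltr01.
rewrite powR1 mul1r addrC => <-.
rewrite addrC; apply: eq_Rintegral => t; rewrite inE/= in_itv/= => /andP[t0 t1].
rewrite addrK divr1 -{1}(prednK n0) -natr1 addrK powR_mulrn//.
by rewrite subr_ge0 ltW.
Qed.

(** * Euler's limit formula for Gamma *)

(** With [y = x/(m+1)], the inequality [1 + u <= exp u] at [u = -y] and at [u = y/(1-y)] gives
    [exp (-y/(1-y)) <= 1 - y <= exp (-y)]. Raised to the power [m], both bounds tend to
    [exp (-x)]. *)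
Lemma cvg_onem_pow_expR {R : realType} (x : R) : 0 < x ->
  (fun m : nat => (1 - x / m.+1%:R) ^+ m) @ \oo --> expR (- x).
Proof.
move=> x0; pose u (m : nat) : R := m.+1%:R^-1.
have u0 : u @ \oo --> (0 : R) by exact: cvg_harmonic.
have u1 : (fun m => 1 - u m) @ \oo --> (1 : R).
  by rewrite -[X in _ --> X]subr0; apply: cvgB => //; exact: cvg_cst.
have xu1 : (fun m => 1 - x * u m) @ \oo --> (1 : R).
  rewrite -[X in _ --> X]subr0; apply: cvgB; first exact: cvg_cst.
  by rewrite -[X in _ --> X](mulr0 x); apply: cvgM => //; exact: cvg_cst.
have mE m : m%:R = (1 - u m) * m.+1%:R :> R.
  by rewrite mulrBl mul1r /u mulVf ?pnatr_eq0// -natr1 addrK.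
apply: (@squeeze_cvgr nat \oo _ R
    (fun m => expR (- x * ((1 - u m) / (1 - x * u m))))
    (fun m => expR (- x * (1 - u m))) _ _ (expR (- x))); last 2 first.
- apply: (@continuous_cvg _ _ _ _ _ _ expR); first exact: continuous_expR.
  rewrite -[X in _ --> X]mulr1; apply: cvgM; first exact: cvg_cst.
  rewrite -[X in _ --> X](mulfV (oner_neq0 R)).
  by apply: cvgM => //; apply: cvgV; rewrite ?oner_neq0.
- apply: (@continuous_cvg _ _ _ _ _ _ expR); first exact: continuous_expR.
  by rewrite -[X in _ --> X]mulr1; apply: cvgM => //; exact: cvg_cst.
near=> m.
have y1 : x * u m < 1.
  rewrite -subr_gt0; near: m; move/cvgr_gt : xu1; exact.
have y0 : 0 <= x * u m by rewrite mulr_ge0 ?(ltW x0)// /u invr_ge0.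
have ym : x * u m * m%:R = x * (1 - u m).
  rewrite mE; have uM : u m * m.+1%:R = 1 by rewrite /u mulVf ?pnatr_eq0.
  by rewrite -mulrA [u m * _]mulrCA uM mulr1.
rewrite -/(u m); set y := x * u m in y0 y1 ym *.
apply/andP; split.
- have -> : - x * ((1 - u m) / (1 - y)) = - (y / (1 - y)) * m%:R.
    by rewrite mulNr mulrA -ym; ring.
  rewrite expRM_natr lerXn2r ?nnegrE ?expR_ge0 ?subr_ge0 ?(ltW y1)//.
  rewrite expRN invf_ple ?posrE ?expR_gt0 ?subr_gt0//.
  apply: le_trans (expR_ge1Dx _).
  rewrite [leLHS](_ : _ = 1 + y / (1 - y))//.
  by field; rewrite gt_eqF// subr_gt0.
- have -> : - x * (1 - u m) = - y * m%:R by rewrite !mulNr ym.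
  rewrite expRM_natr lerXn2r ?nnegrE ?expR_ge0 ?subr_ge0 ?(ltW y1)//.
  exact: expR_ge1Dx.
Unshelve. all: by end_near. Qed.

(** Take logarithms and apply [ln y < y] to [y = x / (2a)]; this choice makes [a y = x/2], half of
    the decay of [exp (-x)]. *)
Lemma powR_le_expR {R : realType} (a x : R) : 0 < a -> 0 < x ->
  x `^ a <= expR (a * ln (2 * a)) * expR (x / 2).
Proof.
move=> a0 x0; rewrite -expRD /powR gt_eqF// ler_expR.
have a20 : 0 < 2 * a by rewrite mulr_gt0.
have y0 : 0 < x / (2 * a) by rewrite divr_gt0.
rewrite -{1}(divfK (lt0r_neq0 a20) x) [X in a * X <= _]lnM ?posrE// mulrDr addrC lerD2l.
have -> : x / 2 = a * (x / (2 * a)) by field; lra.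
by rewrite ler_pM2l// ltW// ln_sublinear.
Qed.

(** Integrability of the dominating function below: it is [2C] times the exponential density of rate
    [1/2]. *)
Lemma expR_half_integrable {R : realType} (C : R) :
  (@lebesgue_measure R).-integrable `]0, +oo[
    (fun x => (C * expR (- (x / 2)))%:E).
Proof.
have h0 : (0 : R) < 2^-1 by rewrite invr_gt0.
refine (@eq_integrable _ _ _ (@lebesgue_measure R) _ (measurable_itv `]0, +oo[)
    (fun x => (C * 2)%:E * (exponential_pdf 2^-1 x)%:E)%E
    (fun x => (C * expR (- (x / 2)))%:E) _ _).
  move=> x; rewrite inE/= in_itv/= andbT => x0.
  rewrite exponential_pdfE ?(ltW x0)// -EFinM mulNr (mulrC _ x).
  by rewrite mulrA mulfK.
apply: integrableZl => //.
exact: integrableS (integrable_exponential_pdf h0).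
Qed.

(** Dominated convergence on the half-line, each integrand being cut off at [m.+1] and extended by
    zero. *)
Lemma Gamma_integral_cvg {R : realType} (a : R) : 0 < a ->
  let f := fun t : R => (t `^ a * expR (- t))%:E in
  (@lebesgue_measure R).-integrable `]0, +oo[ f /\
  (fun m : nat => (m.+1%:R `^ (a + 1) * beta_quot (a + 1) m)%:E) @ \oo -->
    (\int[@lebesgue_measure R]_(t in `]0%R, +oo[) f t)%E.
Proof.
move=> a0 f.
pose h (m : nat) (t : R) := (t `^ a * (1 - t / m.+1%:R) ^+ m)%:E.
pose f_ (m : nat) := (h m) \_ `]0, m.+1%:R[.
have hE m : (\int[@lebesgue_measure R]_(t in `]0%R, +oo[) f_ m t =
    (m.+1%:R `^ (a + 1) * beta_quot (a + 1) m)%:E)%E.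
  have m0 : (0 : R) < m.+1%:R by [].
  rewrite -integral_mkcondr setIidr; last first.
    by move=> t/=; rewrite !in_itv/= andbT => /andP[].
  rewrite -(Rintegral_powR_onem _ _ m a0 m0) /Rintegral fineK//.
  apply: integrable_fin_num => //.
  exact: (integrable_powR_onem _ _ m a0 m0).
have mp : measurable_fun setT (fun t : R => t `^ a) by exact: measurable_powR.
(* The dominating function is the product of [x^a <= exp (a ln (2a)) exp (x/2)] and, for [x < m+1],
   [(1 - x/(m+1))^m <= exp (-x + x/(m+1)) <= exp (1 - x)]. *)
have [] := @dominated_convergence _ _ _ (@lebesgue_measure R) `]0, +oo[ _
   f_ f (fun x => (expR (a * ln (2 * a)) * expR 1 * expR (- (x / 2)))%:E) _ _ _ _ _.
- by [].
- move=> m; apply/measurable_restrict => //.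
  apply: measurable_funTS; apply/measurable_EFinP.
  apply: measurable_funM => //.
  apply: measurable_funX; apply: measurable_funB => //.
  exact: measurable_funM.
- apply: measurable_funTS; apply/measurable_EFinP.
  apply: measurable_funM => //.
  by apply: measurableT_comp => //; exact: measurable_expR.
- apply: aeW => x; rewrite /= in_itv/= andbT => x0.
  apply: cvg_trans (_ : (fun m => h m x) @ \oo --> f x); last first.
    apply: cvg_EFin; first by apply: nearW.
    apply: cvgM; first exact: cvg_cst.
    exact: cvg_onem_pow_expR.
  (* The cutoff is inactive at [x] as soon as [m > x]. *)
  apply: near_eq_cvg; near=> m.
  rewrite /f_ patchE ifT// inE/= in_itv/= x0/=.
  rewrite (@lt_trans _ _ m%:R) ?ltr_nat//.
  near: m; exact: nbhs_infty_gtr.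
- exact: expR_half_integrable.
- apply: aeW => x m; rewrite /= in_itv/= andbT => x0.
  rewrite /f_ patchE; case: ifPn; last first.
    by rewrite abse0 lee_fin !mulr_ge0 ?expR_ge0.
  rewrite inE/= in_itv/= => /andP[_ xm].
  have m0 : (0 : R) < m.+1%:R by [].
  have y1 : 0 <= 1 - x / m.+1%:R by rewrite subr_ge0 ler_pdivrMr// mul1r ltW.
  rewrite lee_fin ger0_norm ?mulr_ge0 ?powR_ge0 ?exprn_ge0//.
  have -> : - (x / 2) = x / 2 - x by field.
  rewrite expRD mulrACA.
  apply: ler_pM; rewrite ?powR_ge0 ?exprn_ge0 ?powR_le_expR//.
  rewrite -expRD; apply: (@le_trans _ _ (expR (- (x / m.+1%:R)) ^+ m)).
    by rewrite lerXn2r ?nnegrE ?expR_ge0// expR_ge1Dx.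
  rewrite -expRM_natr ler_expR.
  have -> : (m%:R : R) = m.+1%:R - 1 by rewrite -natr1 addrK.
  rewrite mulNr mulrBr divfK ?gt_eqF// mulr1 opprB lerD2r.
  by rewrite ler_pdivrMr// mul1r ltW.
- move=> intf _ cvgf; split => //.
  apply: cvg_trans cvgf; apply: near_eq_cvg; apply: nearW => m.
  by rewrite /= hE.
Unshelve. all: by end_near. Qed.

Lemma Beta_cvg_Gamma {R : realType} (a : R) : 0 < a ->
  (fun m : nat => m%:R `^ a * (m%:R * Beta (1 + a) m%:R)) @ \oo -->
    Gamma (1 + a).
Proof.
move=> a0; have [intf cvgf] := Gamma_integral_cvg _ a0.
rewrite -(cvg_shiftS (fun m : nat => m%:R `^ a * (m%:R * Beta (1 + a) m%:R))).
rewrite /Gamma; have -> : 1 + a - 1 = a by ring.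
have /fine_cvg : (m.+1%:R `^ (a + 1) * beta_quot (a + 1) m)%:E @[m --> \oo] -->
    (fine (\int[@lebesgue_measure R]_(t in `]0%R, +oo[)
      (t `^ a * expR (- t))%:E))%:E.
  by rewrite fineK// integrable_fin_num.
apply: cvg_trans; apply: near_eq_cvg; apply: nearW => m /=.
rewrite BetaE//= (addrC a) mulrA; congr (_ * _).
rewrite [RHS]mulrC -mulr_powRB1//; last by rewrite addr_gt0.
by rewrite (addrC 1) addrK.
Qed.

(** On [[1, 2]] the integrand is at least [exp (-2)], because [t^a >= 1] there. *)
Lemma Gamma_gt0 {R : realType} (a : R) : 0 < a -> 0 < Gamma (1 + a).
Proof.
move=> a0; have [intf _] := Gamma_integral_cvg _ a0.
rewrite /Gamma; have -> : 1 + a - 1 = a by ring.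
have mf A : measurable_fun A (fun t : R => (t `^ a * expR (- t))%:E).
  apply: measurable_funTS; apply/measurable_EFinP.
  apply: measurable_funM; first exact: measurable_powR.
  by apply: measurableT_comp => //; exact: measurable_expR.
have f0 (t : R) : 0 <= t `^ a * expR (- t) by rewrite mulr_ge0 ?powR_ge0 ?expR_ge0.
apply: fine_gt0; rewrite -ge0_fin_numE; last first.
  by apply: integral_ge0 => t _; rewrite lee_fin.
rewrite integrable_fin_num// andbT.
apply: lt_le_trans
  (_ : \int[lebesgue_measure]_(t in `[1%R, 2%R]) (expR (- 2))%:E <= _)%E.
  rewrite integral_cst//= lebesgue_measure_itv/= lte_fin ltr1n -EFinB -EFinM.
  by rewrite lte_fin mulr_gt0 ?expR_gt0// subr_gt0 ltr1n.
apply: (@le_trans _ _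
   (\int[lebesgue_measure]_(t in `[1%R, 2%R]) (t `^ a * expR (- t))%:E)%E).
  apply: ge0_le_integral => //=.
  - exact: mf.
  - move=> t; rewrite in_itv/= => /andP[t1 t2].
    rewrite lee_fin -[leLHS]mul1r ler_pM ?expR_ge0 ?ler_expR ?lerN2//.
    by rewrite -(powRr0 t) ler_powR// ltW.
apply: ge0_subset_integral => //=.
- exact: mf.
- by move=> t _; rewrite lee_fin f0.
- by move=> t /=; rewrite !in_itv/= andbT => /andP[t1 _]; rewrite (lt_le_trans _ t1).
Qed.

(** * Asymptotic equivalences *)

Lemma powRN_cvg0 {R : realType} (c : R) : 0 < c ->
  (fun m : nat => m%:R `^ (- c)) @ \oo --> (0 : R).
Proof.
move=> c0; rewrite -(cvg_shiftS (fun m : nat => (m%:R : R) `^ (- c))).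
have := powR_cvg0 c0; move/cvg_at_rightP => /(_ harmonic) h.
apply: cvg_trans (h _); last by split; [move=> m; exact: harmonic_gt0|exact: cvg_harmonic].
apply: near_eq_cvg; apply: nearW => m /=.
by rewrite -powR_inv1// -powRrM mulN1r.
Qed.

Lemma asym_equiv_Beta {R : realType} (a : R) : 0 < a ->
  @asym_equiv R (fun m => m%:R * Beta (1 + a) m%:R)
    (fun m => Gamma (1 + a) / m%:R `^ a).
Proof.
move=> a0; have g0 := Gamma_gt0 _ a0.
rewrite /asym_equiv -[X in _ --> X](divff (lt0r_neq0 g0)).
have -> : (fun m : nat => m%:R * Beta (1 + a) m%:R / (Gamma (1 + a) / m%:R `^ a)) =
    (fun m : nat => m%:R `^ a * (m%:R * Beta (1 + a) m%:R) / Gamma (1 + a)).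
  by apply/funext => m; rewrite invf_div mulrCA mulrA.
by apply: cvgM; [exact: Beta_cvg_Gamma|exact: cvg_cst].
Qed.

(* Both sides are scaled by [m `^ b], the order of the dominant term. *)
Lemma asym_equiv_BetaB {R : realType} (a b : R) : 0 < b -> b < a ->
  @asym_equiv R (fun m => m%:R * Beta (1 + b) m%:R - m%:R * Beta (1 + a) m%:R)
    (fun m => Gamma (1 + b) / m%:R `^ b - Gamma (1 + a) / m%:R `^ a).
Proof.
move=> b0 ba; have a0 := lt_trans b0 ba; have g0 := Gamma_gt0 _ b0.
have ab0 : 0 < a - b by rewrite subr_gt0.
(* The factor left on the [a]-terms after scaling by [m ^ b]; it tends to 0, so only the [b]-terms
   survive. *)
pose q (m : nat) : R := m%:R `^ (- (a - b)).
have q0 : q @ \oo --> (0 : R) by exact: powRN_cvg0.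
pose F (c : R) (m : nat) : R := m%:R `^ c * (m%:R * Beta (1 + c) m%:R).
have num : (fun m => F b m - q m * F a m) @ \oo --> Gamma (1 + b).
  rewrite -[X in _ --> X]subr0 -(mul0r (Gamma (1 + a))).
  by apply: cvgB; [|apply: cvgM => //]; exact: Beta_cvg_Gamma.
have den : (fun m => Gamma (1 + b) - q m * Gamma (1 + a)) @ \oo --> Gamma (1 + b).
  rewrite -[X in _ --> X]subr0 -(mul0r (Gamma (1 + a))).
  by apply: cvgB; [exact: cvg_cst|apply: cvgM => //; exact: cvg_cst].
have gn0 := lt0r_neq0 g0.
rewrite /asym_equiv -[X in _ --> X](divff gn0).
apply: cvg_trans (cvgM num (cvgV gn0 den)); apply: near_eq_cvg.
near=> m.
have m0 : (0 < m)%N by near: m; exact: nbhs_infty_gt.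
have mb : 0 < (m%:R : R) `^ b by rewrite powR_gt0// ltr0n.
have ma : 0 < (m%:R : R) `^ a by rewrite powR_gt0// ltr0n.
have qE : q m = m%:R `^ b / m%:R `^ a.
  by rewrite /q opprB powRB// pnatr_eq0 -lt0n m0 implybT.
have numE : F b m - q m * F a m =
    m%:R `^ b * (m%:R * Beta (1 + b) m%:R - m%:R * Beta (1 + a) m%:R).
  by rewrite /F qE; field; rewrite gt_eqF.
have denE : Gamma (1 + b) - q m * Gamma (1 + a) =
    m%:R `^ b * (Gamma (1 + b) / m%:R `^ b - Gamma (1 + a) / m%:R `^ a).
  by rewrite qE; field; rewrite !gt_eqF.
rewrite /= numE denE.
by rewrite -mulf_div divff ?mul1r ?gt_eqF.
Unshelve. all: by end_near. Qed.

Lemma asym_equiv_invS {R : realType} :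
  @asym_equiv R (fun m => (m.+1%:R)^-1) (fun m => (m%:R)^-1).
Proof.
rewrite /asym_equiv -[X in _ --> X]subr0.
have -> : (fun m : nat => (m.+1%:R : R)^-1 / (m%:R)^-1) =
    (fun m : nat => 1 - harmonic m).
  (* The identity [m/(m+1) = 1 - 1/(m+1)] also covers [m = 0], where the inverse of 0 is 0. *)
  apply/funext => m; rewrite invrK /harmonic/= -natr1; field.
  by rewrite natr1 pnatr_eq0.
by apply: cvgB; [exact: cvg_cst|exact: cvg_harmonic].
Qed.

(** * Joint law of a variable and the maximum of a sample *)

(** Open left rays are stable under intersection, generate the Borel sets and exhaust the line. *)
Lemma finite_measure_unique_rays {R : realType}
    (m1 m2 : {measure set R -> \bar R}) :
  (m1 setT < +oo)%E -> (forall y, m1 `]-oo, y[%classic = m2 `]-oo, y[%classic) ->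
  forall B, measurable B -> m1 B = m2 B.
Proof.
move=> m1T m12 B mB.
apply: (measure_unique (@RGenInftyO.G R) (fun n => `]-oo, n%:R[%classic)) => //.
- exact: RGenInftyO.measurableE.
- move=> _ _ [x ->] [y ->]; exists (Num.min x y).
  apply/seteqP; split => z /=; rewrite !in_itv/= lt_min; first by move=> [-> ->].
  by move=> /andP[].
- by move=> n; exists n%:R.
- apply/seteqP; split => // z _; exists (Num.bound `|z|) => //=.
  by rewrite in_itv/= (le_lt_trans (ler_norm z))// archi_boundP.
- by move=> _ [y ->].
- move=> n; apply: le_lt_trans m1T; apply: le_measure; rewrite ?inE//.
Qed.

Lemma law_rays_indep {R : realType} {d : measure_display} {T : measurableType d}
    (P : probability T R) (X M : {mfun T >-> R}) (A B : set R) : measurable A ->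
  (forall y, P (X @^-1` A `&` M @^-1` `]-oo, y[) =
    (P (X @^-1` A) * P (M @^-1` `]-oo, y[))%E) ->
  measurable B ->
  P (X @^-1` A `&` M @^-1` B) = (P (X @^-1` A) * P (M @^-1` B))%E.
Proof.
move=> mA PI mB.
have mXA : measurable (X @^-1` A) by exact: measurable_funPTI.
have PXA : P (X @^-1` A) \is a fin_num by exact: fin_num_measure.
have r0 : 0 <= fine (P (X @^-1` A)) by exact: fine_ge0.
have mM : measurable_fun setT M by exact: measurable_funPT.
have [m1 m1E] : exists m : {measure set R -> \bar R},
    forall C, m C = P (X @^-1` A `&` M @^-1` C).
  unshelve refine (ex_intro _ (pushforward (mrestr P mXA) M : {measure set R -> \bar R}) _).
    exact: mM.
  by move=> C; rewrite setIC.
have [m2 m2E] : exists m : {measure set R -> \bar R},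
    forall C, m C = (P (X @^-1` A) * P (M @^-1` C))%E.
  exists (mscale (NngNum r0) (distribution P M)) => C.
  by congr (_ * _)%E; exact: fineK.
rewrite -m1E -m2E; apply: finite_measure_unique_rays => //.
- by rewrite m1E setIT ltey_eq PXA.
- by move=> y; rewrite m1E m2E.
Qed.

(** The joint law agrees with the product of the marginals on rectangles, hence equals it; the
    product measure is by construction the integral of its sections. *)
Lemma law_product {R : realType} {d : measure_display} {T : measurableType d}
    (P : probability T R) (X M : {mfun T >-> R}) (C : set (R * R)) :
  (forall A y, measurable A -> P (X @^-1` A `&` M @^-1` `]-oo, y[) =
    (P (X @^-1` A) * P (M @^-1` `]-oo, y[))%E) ->
  measurable C ->
  P [set w | C (X w, M w)] =
  (\int[distribution P X]_x P [set w | C (x, M w)])%E.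
Proof.
move=> PI mC.
have mXM : measurable_fun setT (fun w => (X w, M w)) by exact: measurable_fun_pair.
have [m' m'E] : exists m : {measure set (R * R) -> \bar R},
    forall D, m D = P [set w | D (X w, M w)].
  unshelve refine (ex_intro _ (pushforward P (fun w => (X w, M w)) :
    {measure set (R * R) -> \bar R}) _).
    exact: mXM.
  by [].
have := @product_measure_unique _ _ _ _ _ (distribution P X) (distribution P M) m' _ C mC.
rewrite /product_measure1 m'E => <-; last first.
  by move=> A B mA mB; rewrite m'E; apply: law_rays_indep => // y; exact: PI.
apply: eq_integral => x _ /=; congr (P _).
by apply/seteqP; split => w; rewrite /xsection/= inE.
Qed.

(** [g] and the Radon-Nikodym derivative of [nu] have the same integral over every measurable set,
    so they agree almost everywhere. *)
Lemma integral_density {R : realType} (nu : probability (measurableTypeR R) R) (g : R -> R) :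
  measurable_fun setT g ->
  (forall A, measurable A -> nu A = \int[lebesgue_measure]_(x in A) (g x)%:E)%E ->
  forall D f, measurable D -> nu.-integrable D f ->
  (\int[nu]_(x in D) f x = \int[lebesgue_measure]_(x in D) (f x * (g x)%:E))%E.
Proof.
move=> mg nuE D f mD intf.
have dom : nu `<< @lebesgue_measure R.
  apply/null_content_dominatesP => A mA muA0; rewrite nuE//.
  apply: null_set_integral => //.
  by apply: measurable_funTS; exact/measurable_EFinP.
have mf := measurable_int _ intf.
rewrite -(Radon_Nikodym_change_of_variables dom)//=.
apply: ae_eq_integral => //.
- apply: emeasurable_funM => //; apply: (measurable_int lebesgue_measure).
  apply: (integrableS _ _ (@subsetT _ _)) => //=.
  exact: Radon_Nikodym_integrable.
- apply: emeasurable_funM => //.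
  by apply: measurable_funTS; exact/measurable_EFinP.
apply: ae_eqe_mul2l => /=; apply: integral_ae_eq => //=.
- apply: (integrableS _ _ (@subsetT _ _)) => //=.
  exact: Radon_Nikodym_integrable.
- by apply: measurable_funTS; exact/measurable_EFinP.
- by move=> E ED mE; rewrite -Radon_Nikodym_integral//= nuE.
Qed.

(** * Exponential moments as Beta quotients *)

(** The identity [n B(1+a, n) = a B(a, n+1)] with [n] shifted by one: it links the value produced by
    the exponential moment to the form used in the bounds. *)
Lemma beta_quot_mul {R : realType} (a : R) (n : nat) : 0 < a ->
  n.+1%:R * beta_quot (1 + a) n = a * beta_quot a n.+1.
Proof.
move=> a0; rewrite /beta_quot [in RHS]big_ord_recl addr0.
have -> : \prod_(i < n.+1) (a + (lift ord0 i)%:R) = \prod_(i < n.+1) (1 + a + i%:R).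
  by apply: eq_bigr => j _; rewrite lift0 -natr1 addrA addrAC (addrC a).
have B0 : 0 < \prod_(i < n.+1) (1 + a + i%:R).
  by apply: prodr_gt0 => j _; rewrite ltr_wpDr// addr_gt0.
by rewrite factS natrM; field; rewrite !gt_eqF.
Qed.

Lemma beta_quot1 {R : realType} (n : nat) : beta_quot (1 : R) n = n.+1%:R^-1.
Proof.
rewrite /beta_quot; have -> : \prod_(j < n.+1) (1 + j%:R) = n.+1`!%:R :> R.
  elim: n => [|n IH]; first by rewrite big_ord1 addr0.
  by rewrite big_ord_recr /= IH [in RHS]factS natrM nat1r mulrC.
by rewrite factS natrM invfM mulrCA mulfV ?mulr1// pnatr_eq0 -lt0n fact_gt0.
Qed.

Lemma exponential_prob_ray {R : realType} (lam y : R) : 0 < y ->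
  exponential_prob lam `]-oo, y[%classic = (1 - expR (- lam * y))%:E.
Proof.
move=> y0; have := exponential_prob_itv0c lam y0.
rewrite EFinB => <-; rewrite /exponential_prob /exponential_pdf.
have E D : (\int[@lebesgue_measure R]_(x in D)
    (((fun x => lam * expR (- lam * x)) \_ `[0, +oo[) x)%:E =
    \int[lebesgue_measure]_(x in D `&` `[0%R, +oo[) (lam * expR (- lam * x))%:E)%E.
  by rewrite integral_mkcondr; apply: eq_integral => x _; rewrite !patchE; case: ifP.
rewrite !E.
have -> : `]-oo, y[ `&` `[0, +oo[ = `[0, y[%classic.
  apply/seteqP; split => x /=; rewrite !in_itv/= ?andbT; first by move=> [-> ->].
  by move=> /andP[-> ->].
have -> : `[0, y] `&` `[0, +oo[ = `[0, y]%classic.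
  apply/seteqP; split => x /=; rewrite !in_itv/= ?andbT; first by move=> [].
  by move=> /andP[-> ->].
apply: integral_itv_bndo_bndc; apply: measurable_funTS; apply/measurable_EFinP.
apply: measurable_funM => //; apply: measurableT_comp; first exact: measurable_expR.
exact: measurable_funM.
Qed.

Lemma exponential_prob_Nray {R : realType} (lam : R) :
  exponential_prob lam `]-oo, 0%R[%classic = 0%E.
Proof.
apply: integral0_eq => x /=; rewrite in_itv/= => x0.
by rewrite lt0_exponential_pdf.
Qed.

Lemma integral_exponential_pdf0y {R : realType} (r : R) : 0 < r ->
  (\int[@lebesgue_measure R]_(x in `[0%R, +oo[) (exponential_pdf r x)%:E = 1)%E.
Proof.
move=> r0; rewrite integral_mkcond -(integral_exponential_pdf r0).
apply: eq_integral => x _; rewrite patchE; case: ifPn => //.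
by rewrite notin_setE/= in_itv/= andbT => /negP; rewrite -ltNge => /lt0_exponential_pdf ->.
Qed.

(** The weight [exp (-lam x (c-a)/a)] in [h] embeds the moment, the case [c = a], in a family
    obeying the Beta recursion: multiplying by [exp (-lam x/a)] raises [c] by one. For [c >= a] the
    weight is at most 1 on the half-line. *)
Lemma exponential_moment {R : realType} (nu : probability (measurableTypeR R) R)
    (lam a : R) (n : nat) : 0 < lam -> 0 < a ->
  (forall A, measurable A -> nu A = exponential_prob lam A) ->
  (\int[nu]_(x in `[0%R, +oo[) ((1 - expR (- lam * (x / a))) ^+ n)%:E =
    (a * beta_quot a n)%:E)%E.
Proof.
move=> lam0 a0 nuE.
pose h (c : R) (k : nat) (x : R) :=
  expR (- lam * (x / a) * (c - a)) * (1 - expR (- lam * (x / a))) ^+ k.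
have ih c k : a <= c -> nu.-integrable `[0, +oo[ (EFin \o h c k).
  move=> ac; apply: measurable_bounded_integrable => //.
  - by rewrite (le_lt_trans (probability_le1 nu _))// ltry.
  - apply: measurable_funTS; apply: measurable_funM.
      apply: measurableT_comp; first exact: measurable_expR.
      by apply: measurable_funM => //; apply: measurable_funM => //; exact: measurable_funM.
    apply: measurable_funX; apply: measurable_funB => //.
    apply: measurableT_comp; first exact: measurable_expR.
    by apply: measurable_funM => //; exact: measurable_funM.
  - exists 1; split; first exact: num_real.
    move=> M M1 x /=; rewrite in_itv/= andbT => x0; apply: le_trans (ltW M1).
    have xa : - lam * (x / a) <= 0.
      by rewrite mulNr oppr_le0 mulr_ge0// ?divr_ge0// ltW.
    have e1 : expR (- lam * (x / a)) <= 1 by rewrite -expR0 ler_expR.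
    have u0 : 0 <= 1 - expR (- lam * (x / a)) by rewrite subr_ge0.
    rewrite ger0_norm ?mulr_ge0 ?expR_ge0 ?exprn_ge0//.
    rewrite -[leRHS]mulr1 ler_pM ?expR_ge0 ?exprn_ge0//.
      by rewrite -expR0 ler_expR mulr_le0_ge0// subr_ge0.
    by rewrite exprn_ile1// gerBl expR_ge0.
pose F c k := \int[nu]_(x in `[0%R, +oo[) h c k x / a.
suff FE : F a n = beta_quot a n.
  rewrite -FE /F mulrCA mulfV ?gt_eqF// mulr1 /Rintegral fineK.
    by apply: eq_integral => x _; rewrite /h subrr mulr0 expR0 mul1r.
  by apply: integrable_fin_num => //; exact: ih.
apply: (beta_quot_uniq a) => //.
- move=> c ac; rewrite /F /Rintegral.
  have c0 : 0 < c by rewrite (lt_le_trans a0).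
  have r0 : 0 < lam / a * c by rewrite mulr_gt0// divr_gt0.
  rewrite (integral_density _ _ (measurable_exponential_pdf lam))//; last exact: ih.
  under eq_integral => x.
    rewrite inE/= in_itv/= andbT => x0.
    (* Tilting the density of rate [lam] by the weight gives, up to the factor [a/c], the density of
       rate [lam c/a], which has mass 1. *)
    have -> : ((h c 0%N x)%:E * (exponential_pdf lam x)%:E =
        (a / c)%:E * (exponential_pdf (lam / a * c) x)%:E)%E.
      rewrite !exponential_pdfE// -!EFinM; congr (_%:E).
      rewrite /h expr0 mulr1 mulrCA -expRD.
      have -> : - lam * (x / a) * (c - a) + - lam * x = - (lam / a * c) * x.
        by field; rewrite gt_eqF.
      by field; rewrite !gt_eqF.
    over.
  rewrite ge0_integralZl//.
  + by rewrite integral_exponential_pdf0y// mule1/=; field; rewrite !gt_eqF.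
  + by apply: measurable_funTS; apply/measurable_EFinP; exact: measurable_exponential_pdf.
  + by move=> x _; rewrite lee_fin exponential_pdf_ge0// ltW.
  + by rewrite lee_fin divr_ge0// ltW.
- move=> c k ac; rewrite /F -mulrBl; congr (_ / _).
  have ac1 : a <= c + 1 by rewrite (le_trans ac)// lerDl.
  rewrite -RintegralB//; [|exact: ih..].
  apply: eq_Rintegral => x _; rewrite /h exprS.
  have -> : c + 1 - a = (c - a) + 1 by ring.
  by rewrite [_ * (c - a + 1)]mulrDr mulr1 expRD; ring.
Qed.

(** * Distribution of the sample maximum *)

Lemma measurable_set_ltr {R : realType} {d : measure_display}
    {T : measurableType d} (f g : T -> R) :
  measurable_fun setT f -> measurable_fun setT g ->
  measurable [set x | f x < g x].
Proof.
move=> mf mg; rewrite -[X in measurable X]setTI.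
exact: (measurable_fun_ltr mf mg measurableT (Y := [set true])).
Qed.

Lemma measurable_set_ler {R : realType} {d : measure_display}
    {T : measurableType d} (f g : T -> R) :
  measurable_fun setT f -> measurable_fun setT g ->
  measurable [set x | f x <= g x].
Proof.
move=> mf mg; rewrite -[X in measurable X]setTI.
exact: (measurable_fun_ler mf mg measurableT (Y := [set true])).
Qed.

Lemma measurable_sample_max {R : realType} {d : measure_display}
    {T : measurableType d} {n : nat} (Xs : 'I_n -> {mfun T >-> R}) :
  measurable_fun setT (sample_max (fun i => (Xs i : T -> R))).
Proof.
rewrite /sample_max; elim: (index_enum _) => [|i s IH].
  under eq_fun do rewrite big_nil.
  exact: measurable_cst.
under eq_fun do rewrite big_cons.
exact: measurable_maxr.
Qed.

Lemma sample_max_ge0 {T : Type} {R : realType} {n : nat} (Xs : 'I_n -> T -> R) w :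
  0 <= sample_max Xs w.
Proof. exact: bigmax_ge_id. Qed.

(** [0 < y] accounts for the value [0] from which the maximum starts. *)
Lemma sample_max_ray {T : Type} {R : realType} {n : nat} (Xs : 'I_n -> T -> R) y :
  0 < y -> sample_max Xs @^-1` `]-oo, y[ =
    \bigcap_(i in [set: 'I_n]) (Xs i @^-1` `]-oo, y[).
Proof.
move=> y0; apply/seteqP; split => w /=.
  by rewrite in_itv/= => /bigmax_ltP[_ h] i _ /=; rewrite in_itv/= h.
move=> h; rewrite in_itv/=; apply/bigmax_ltP; split => // i _.
by have := h i I; rewrite /= in_itv.
Qed.

Lemma mutually_independent_rays {R : realType} {d : measure_display}
    {T : measurableType d} (P : probability T R) {n : nat}
    (X : T -> R) (Xs : 'I_n -> T -> R) (A : set R) (y : R) :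
  mutually_independent P (family_XXs X Xs) -> measurable A ->
  P (X @^-1` A `&` \bigcap_(i in [set: 'I_n]) (Xs i @^-1` `]-oo, y[)) =
  (P (X @^-1` A) * \prod_(i < n) P (Xs i @^-1` `]-oo, y[%classic))%E.
Proof.
move=> PI mA.
pose B (o : option 'I_n) : set R := if o is None then A else `]-oo, y[%classic.
have mB o : measurable (B o) by rewrite /B; case: o.
have := PI B mB.
rewrite (bigD1 None)//= (reindex_omap Some id)/=; last by case.
under eq_bigl do rewrite eqxx.
move=> <-; congr (P _); apply/seteqP; split => w /=.
  by move=> [XA h] [i|] _ //=; exact: h.
by move=> h; split=> [|i _]; [exact: (h None)|exact: (h (Some i))].
Qed.

Lemma cdf_sample_max {R : realType} {d : measure_display}
    {T : measurableType d} (P : probability T R) {n : nat} (lam y : R)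
    (X : T -> R) (Xs : 'I_n -> {RV P >-> R}) : 0 < y ->
  mutually_independent P (family_XXs X (fun i => (Xs i : T -> R))) ->
  (forall i A, measurable A -> distribution P (Xs i) A = exponential_prob lam A) ->
  P (sample_max (fun i => (Xs i : T -> R)) @^-1` `]-oo, y[) =
    ((1 - expR (- lam * y)) ^+ n)%:E.
Proof.
move=> y0 PI PXs.
have := mutually_independent_rays _ _ _ _ y PI measurableT.
rewrite preimage_setT setTI probability_setT mul1e -sample_max_ray// => ->.
under eq_bigr => i _.
  have -> : P (Xs i @^-1` `]-oo, y[%classic) = (1 - expR (- lam * y))%:E.
    by rewrite -exponential_prob_ray// -(PXs i).
  over.
elim: n {X Xs PI PXs} => [|n IH]; first by rewrite big_ord0 expr0.
by rewrite big_ord_recl IH exprS EFinM.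
Qed.

Lemma prob_gt_sample_max {R : realType} {d : measure_display}
    {T : measurableType d} (P : probability T R) {n : nat} (lam a : R)
    (X : {RV P >-> R}) (Xs : 'I_n -> {RV P >-> R}) :
  0 < lam -> 0 < a -> (0 < n)%N ->
  mutually_independent P (family_XXs (X : T -> R) (fun i => (Xs i : T -> R))) ->
  (forall A, measurable A -> distribution P X A = exponential_prob lam A) ->
  (forall i A, measurable A -> distribution P (Xs i) A = exponential_prob lam A) ->
  P [set w | a * sample_max (fun i => (Xs i : T -> R)) w < X w] =
    (a * beta_quot a n)%:E.
Proof.
move=> lam0 a0 n0 PI PX PXs.
set M := sample_max _.
have mM : measurable_fun setT M by exact: measurable_sample_max.
pose M' : {mfun T >-> R} := mfun_Sub (mem_set mM).
have M0 w : 0 <= M w by exact: sample_max_ge0.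
have Mlt0 y : y <= 0 -> M @^-1` `]-oo, y[ = set0.
  move=> y0; apply/seteqP; split => // w /=; rewrite in_itv/=.
  by apply/negP; rewrite -leNgt (le_trans y0).
have mC : measurable [set p : R * R | a * p.2 < p.1].
  apply: measurable_set_ltr; last exact: measurable_fst.
  by apply: measurable_funM => //; exact: measurable_snd.
have := @law_product _ _ _ P X M' _ _ mC => -> /=; last first.
  (* For [y <= 0] the ray event of the nonnegative [M] is empty; otherwise it splits into
     independent ray events of the sample. *)
  move=> A y mA; have [y0|y0] := ltP 0 y; last by rewrite Mlt0// setI0 measure0 mule0.
  have := mutually_independent_rays _ _ _ _ y PI measurableT.
  rewrite preimage_setT setTI probability_setT mul1e => PM.
  by rewrite sample_max_ray// mutually_independent_rays// PM.
pose g : R -> \bar R :=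
  (fun x => ((1 - expR (- lam * (x / a))) ^+ n)%:E) \_ `[0%R, +oo[.
have g0 x : (0 <= g x)%E.
  rewrite /g patchE; case: ifPn => //; rewrite inE/= in_itv/= andbT => x0.
  rewrite lee_fin exprn_ge0// subr_ge0 -expR0 ler_expR mulNr oppr_le0.
  by rewrite !mulr_ge0 ?invr_ge0 ?(ltW lam0) ?(ltW a0).
have mg : measurable_fun setT g.
  apply/measurable_restrict => //; rewrite setTI; apply: measurable_funTS.
  apply/measurable_EFinP; apply: measurable_funX; apply: measurable_funB => //.
  apply: measurableT_comp; first exact: measurable_expR.
  by apply: measurable_funM => //; exact: measurable_funM.
(* [R] and [measurableTypeR R] have the same measurable sets under distinct
   displays; the change of variables through [P] moves between them. *)
have mX : measurable_fun setT (X : T -> measurableTypeR R).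
  by move=> _ B mB; rewrite setTI; exact: (measurable_funPTI X).
pose X' : {mfun T >-> measurableTypeR R} :=
  @mfun_Sub _ _ T (measurableTypeR R) X (mem_set mX).
transitivity (\int[distribution P X]_x g x)%E; last first.
  rewrite ge0_integral_distribution// -(ge0_integral_distribution X' mg g0).
  by rewrite -(exponential_moment (distribution P X') _ _ n lam0 a0 PX) [RHS]integral_mkcond.
apply: eq_integral => x _; rewrite /g patchE.
have -> : [set w | a * M w < x] = M @^-1` `]-oo, x / a[.
  by apply/seteqP; split => w /=; rewrite in_itv/= ltr_pdivlMr// mulrC.
have [x0|x0] := ltP 0 x.
  rewrite ifT; last by rewrite inE/= in_itv/= (ltW x0).
  by rewrite (cdf_sample_max _ lam _ _ _ _ PI PXs)// divr_gt0.
rewrite Mlt0 ?measure0; last by rewrite pmulr_lle0 ?invr_gt0.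
(* Only [x = 0] remains, where [(1 - 1)^n = 0] because [n] is positive. *)
case: ifPn => //; rewrite inE/= in_itv/= andbT => x0'.
have -> : x = 0 by apply/le_anti; rewrite x0 x0'.
by rewrite mul0r mulr0 expR0 subrr expr0n gtn_eqF.
Qed.

(** As [n > 0], there is a sample point below the maximum, and it is almost surely positive. *)
Lemma sample_max_le0_null {R : realType} {d : measure_display}
    {T : measurableType d} (P : probability T R) {n : nat} (lam : R)
    (Xs : 'I_n -> {RV P >-> R}) : (0 < n)%N ->
  (forall i A, measurable A -> distribution P (Xs i) A = exponential_prob lam A) ->
  P [set w | sample_max (fun i => (Xs i : T -> R)) w <= 0] = 0%E.
Proof.
move=> n0 PXs; pose i := Ordinal n0.
have mM := measurable_sample_max Xs.
apply/eqP; rewrite eq_le measure_ge0 andbT.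
have <- : P (Xs i @^-1` `]-oo, 0%R]) = 0%E.
  rewrite -[LHS]/(distribution P (Xs i) `]-oo, 0%R]%classic) PXs//.
  rewrite -(exponential_prob_Nray lam); apply/esym/integral_itv_bndo_bndc.
  apply: measurable_funTS; apply/measurable_EFinP; exact: measurable_exponential_pdf.
apply: le_measure; rewrite ?inE.
- exact: measurable_set_ler.
- exact: measurable_funPTI.
- move=> w /= h; rewrite in_itv/=; apply: le_trans h.
  exact: (le_bigmax _ (fun j => Xs j w) i).
Qed.

(** * Rounding up to powers of [rho], and the bounds *)

Lemma ceil_logb_itv {R : realType} (rho x : R) : 1 < rho -> 0 < x ->
  x <= rho ^ Num.ceil (logb rho x) < rho * x.
Proof.
move=> rho1 x0; have rho0 : 0 < rho by rewrite (lt_trans ltr01).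
have l0 : 0 < ln rho by rewrite ln_gt0.
set K := Num.ceil _.
have -> : rho ^ K = expR (K%:~R * ln rho) by rewrite -powR_intmul ?(ltW rho0)// /powR gt_eqF.
have /andP[lo hi] : (K - 1)%:~R < logb rho x <= K%:~R by exact: ceil_itv.
apply/andP; split.
  by rewrite -{1}(lnK x0) ler_expR -ler_pdivrMr.
rewrite -[ltRHS](_ : expR (ln rho + ln x) = _); last by rewrite expRD !lnK.
rewrite ltr_expR -ltrBlDl.
by move: lo; rewrite /logb ltr_pdivlMr// intrB mulrBl mul1r.
Qed.

(** [y |-> rho ^ ceil y] is nondecreasing for [rho > 1], hence measurable. *)
Lemma measurable_exprz_ceil_logb {R : realType} (rho : R) : 1 < rho ->
  measurable_fun setT (fun x : R => rho ^ Num.ceil (logb rho x)).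
Proof.
move=> rho1.
have -> : (fun x : R => rho ^ Num.ceil (logb rho x)) =
  (fun y : R => rho ^ Num.ceil y) \o logb rho by [].
apply: measurableT_comp.
  apply: nondecreasing_measurable => // x y xy.
  by rewrite ler_eXz2l// le_ceil.
by apply: measurable_funM => //; exact: measurable_ln.
Qed.

Theorem theorem4 (R : realType) (d : measure_display) (T : measurableType d)
  (P : probability T R) (lam rho : R) (n : nat)
  (X : {RV P >-> R}) (Xs : 'I_n -> {RV P >-> R}) :
  0 < lam -> 1 < rho -> (1 <= n)%N ->
  mutually_independent P (family_XXs (X : T -> R) (fun i => (Xs i : T -> R))) ->
  (forall A, measurable A -> distribution P X A = exponential_prob lam A) ->
  (forall i A, measurable A -> distribution P (Xs i) A = exponential_prob lam A) ->
  let K := fun w => Num.ceil (logb rho (sample_max (fun i => (Xs i : T -> R)) w)) in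
  let p_last := P [set w | rho ^ (K w - 1) < X w <= rho ^ (K w)] in
  let p_tail := P [set w | rho ^ (K w) < X w] in
  [/\ (p_last <= (n%:R * Beta (1 + rho^-1) n%:R - n%:R * Beta (1 + rho) n%:R)%:E)%E,
      ((n%:R * Beta (1 + rho) n%:R)%:E <= p_tail)%E,
      (p_tail <= (n.+1%:R)^-1%:E)%E &
   [/\       @asym_equiv R (fun m => m%:R * Beta (1 + rho^-1) m%:R - m%:R * Beta (1 + rho) m%:R)
                 (fun m => Gamma (1 + rho^-1) / m%:R `^ (rho^-1) - Gamma (1 + rho) / m%:R `^ rho),
      @asym_equiv R (fun m => m%:R * Beta (1 + rho) m%:R) (fun m => Gamma (1 + rho) / m%:R `^ rho)
    & @asym_equiv R (fun m => (m.+1%:R)^-1) (fun m => (m%:R)^-1)]].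
Proof.
move=> lam0 rho1 n0 PI PX PXs K p_last p_tail.
have rho0 : 0 < rho by rewrite (lt_trans ltr01).
pose M := sample_max (fun i => (Xs i : T -> R)).
have mM : measurable_fun setT M by exact: measurable_sample_max.
have mX : measurable_fun setT X by exact: measurable_funPT.
pose N := [set w | M w <= 0].
(* On [N] the junk value [ln 0 = 0] makes [M <= rho ^ K < rho * M] fail. *)
have N0 : P N = 0%E by exact: sample_max_le0_null PXs.
have mN : measurable N by exact: measurable_set_ler.
pose G a := [set w | a * M w < X w].
have mG a : measurable (G a).
  by apply: measurable_set_ltr => //; exact: measurable_funM.
have PG a : 0 < a -> P (G a) = (n%:R * Beta (1 + a) n%:R)%:E.
  move=> a0; rewrite (prob_gt_sample_max _ lam)//; congr (_%:E).
  by rewrite BetaE// -{1}(prednK n0) -beta_quot_mul// prednK.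
have mrho : measurable_fun setT (fun w => rho ^ K w).
  exact: (measurableT_comp (measurable_exprz_ceil_logb _ rho1) mM).
have mtail : measurable [set w | rho ^ K w < X w] by exact: measurable_set_ltr.
have KE w : rho ^ (K w - 1) = rho ^ K w / rho by rewrite expfzDr ?gt_eqF.
have Kitv w : ~ N w -> M w <= rho ^ K w < rho * M w.
  by move=> /negP; rewrite -ltNge; exact: ceil_logb_itv.
split.
(* The bound is the probability of [M / rho < X <= rho * M], a difference of nested events. *)
- have -> : (n%:R * Beta (1 + rho^-1) n%:R - n%:R * Beta (1 + rho) n%:R)%:E =
      P (G rho^-1 `\` G rho).
    have GS : G rho `<=` G rho^-1.
      move=> w; apply: le_lt_trans.
      rewrite ler_wpM2r ?sample_max_ge0// (@le_trans _ _ 1) ?(ltW rho1)//.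
      by rewrite invf_le1// ltW.
    rewrite EFinB -!PG ?invr_gt0// measureD ?(setIidr GS)//.
    by rewrite ltey_eq fin_num_measure.
  (* Adding the null event [N] to the larger side leaves the inclusion to be checked only where
     [Kitv] applies. *)
  rewrite -(measureU0 _ mN N0); last exact: measurableD.
  apply: le_measure; rewrite ?inE.
  + rewrite (_ : [set _ | _] = [set w | rho ^ (K w - 1) < X w] `&`
        [set w | X w <= rho ^ K w]); last first.
      by apply/seteqP; split => w /= => [/andP|] // [-> ->].
    apply: measurableI; last exact: measurable_set_ler.
    apply: measurable_set_ltr => //.
    by under eq_fun do rewrite KE; exact: measurable_funM.
  + by apply: measurableU => //; exact: measurableD.
  + move=> w /= /andP[lo hi]; have [Nw|Nw] := pselect (N w); [by right|left].
    have /andP[h1 h2] := Kitv w Nw; split => /=.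
      by apply: le_lt_trans lo; rewrite KE mulrC ler_pM2r ?invr_gt0.
    by apply/negP; rewrite -leNgt (le_trans hi)// ltW.
- rewrite -PG// /p_tail -(measureU0 mtail mN N0).
  apply: le_measure; rewrite ?inE//; first exact: measurableU.
  move=> w /= h; have [Nw|Nw] := pselect (N w); [by right|left].
  by have /andP[_ h2] := Kitv w Nw; exact: lt_trans h.
(* Off [N] the tail event forces [X] above the whole sample, the case [a = 1]. *)
- have -> : (n.+1%:R)^-1%:E = P (G 1).
    by rewrite (prob_gt_sample_max _ lam)// beta_quot1 mul1r.
  rewrite -(measureU0 _ mN N0)// /p_tail.
  apply: le_measure; rewrite ?inE//; first exact: measurableU.
  move=> w /= h; have [Nw|Nw] := pselect (N w); [by right|left].
  have /andP[h1 _] := Kitv w Nw; rewrite /G/= mul1r; exact: le_lt_trans h.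
- split; [|exact: asym_equiv_Beta|exact: asym_equiv_invS].
  apply: asym_equiv_BetaB; first by rewrite invr_gt0.
  by rewrite (lt_trans _ rho1)// invf_lt1.
Qed.
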